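(* For every monotone subset $Q\subseteq\mathsf{List}(\mathbb{N})$: if $\mathrm{TBar}([\,],Q)$ holds (i.e. $Q$ is a bar over the empty list realized by a closed System T term of type $(\mathsf{nat}\to\mathsf{nat})\to\mathsf{nat}$), then $\mathrm{IndBar}([\,],Q)$ holds.
   Context: Setting: constructive metatheory (e.g. Martin-Löf type theory with function extensionality; no excluded middle, no axiom of choice). Lists and sequences. $\mathsf{List}(\mathbb{N})$ is the set of finite lists of naturals, $[\,]$ the empty list, $\vec u\cdot\vec v$ concatenation, $\vec u\cdot x$ the list $\vec u$ with the element $x$ appended at the end. $\vec u\preceq\vec v$ means $\vec u$ is a prefix of $\vec v$. For $\alpha:\mathbb{N}\to\mathbb{N}$, $\alpha[k]$ is the list of the first $k$ values of $\alpha$. A subset $Q\subseteq\mathsf{List}(\mathbb{N})$ (not assumed decidable) is monotone if $\vec v\in Q$ and $\vec v\preceq\vec w$ imply $\vec w\in Q$. Inductive barhood. $\mathrm{IndBar}(\vec u,Q)$ is the inductively generated predicate with two rules: (η) if $\vec u\in Q$ then $\mathrm{IndBar}(\vec u,Q)$; (ϝ) if $\mathrm{IndBar}(\vec u\cdot x,Q)$ for all $x:\mathbb{N}$, then $\mathrm{IndBar}(\vec u,Q)$. System T. Types: $\sigma,\tau ::= \mathsf{nat}\mid\sigma\to\tau$. A context $\Gamma$ assigns types to finitely many distinct variables. Terms, up to $\alpha$-equivalence: variables $x$; $\lambda x.M$; application $M(N)$ (annotated with the domain type); $\mathsf{z}$; $\mathsf{s}(M)$; $\mathsf{rec}(N;M_z;x.h.M_s)$.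 Typing $\Gamma\vdash M:\sigma$ is the usual simply typed one, with $\Gamma\vdash\mathsf{z}:\mathsf{nat}$; $\Gamma\vdash\mathsf{s}(M):\mathsf{nat}$ if $\Gamma\vdash M:\mathsf{nat}$; and $\Gamma\vdash\mathsf{rec}(N;M_z;x.h.M_s):\sigma$ if $\Gamma\vdash N:\mathsf{nat}$, $\Gamma\vdash M_z:\sigma$ and $\Gamma,x:\mathsf{nat},h:\sigma\vdash M_s:\sigma$. Standard semantics. $[\![\mathsf{nat}]\!]=\mathbb{N}$, $[\![\sigma\to\tau]\!]=[\![\sigma]\!]\to[\![\tau]\!]$ (all functions), $[\![\Gamma]\!]=\prod_{x\in\mathrm{dom}\,\Gamma}[\![\Gamma(x)]\!]$. A term $\Gamma\vdash M:\sigma$ is interpreted as the evident function $[\![M]\!]:[\![\Gamma]\!]\to[\![\sigma]\!]$ (variables by lookup, abstraction and application by functions, $\mathsf{z}$ as $0$, $\mathsf{s}$ as successor, $\mathsf{rec}$ by primitive recursion: $r(0)=[\![M_z]\!]g$ and $r(n+1)=[\![M_s]\!](g,x\mapsto n,h\mapsto r(n))$, evaluated at $[\![N]\!]g$). T-realizable barhood. $\mathrm{TBar}(\vec u,Q)$ means: there is a closed term $\cdot\vdash F:(\mathsf{nat}\to\mathsf{nat})\to\mathsf{nat}$ such that for all $\alpha:\mathbb{N}\to\mathbb{N}$, $\vec u\cdot\alpha\big[[\![F]\!](\alpha)\big]\in Q$. *)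

(* Defs.v *)
From mathcomp Require Import all_boot.

Set Implicit Arguments.
Unset Strict Implicit.
Unset Printing Implicit Defensive.

(* A subset of List(N) is a Prop-valued predicate, so it need not be
   decidable. *)
Definition monotone (Q : seq nat -> Prop) : Prop :=
  forall v w : seq nat, Q v -> prefix v w -> Q w.

Inductive IndBar (Q : seq nat -> Prop) : seq nat -> Prop :=
| IndBar_eta (u : seq nat) : Q u -> IndBar Q u
| IndBar_digamma (u : seq nat) :
    (forall x : nat, IndBar Q (rcons u x)) -> IndBar Q u.

(* System T, intrinsically typed with de Bruijn indices: terms are thereby
   identified up to alpha-equivalence, and an inhabitant of [tm G s] is a
   typing derivation G |- M : s.  The head of a context is the most recently
   bound variable. *)
Inductive ty : Set :=
| Nat : ty
| Arr : ty -> ty -> ty.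

Definition ctx : Set := seq ty.

Inductive var : ctx -> ty -> Set :=
| VZ (G : ctx) (s : ty) : var (s :: G) s
| VS (G : ctx) (s t : ty) : var G s -> var (t :: G) s.

(* In [Rec N Mz Ms], standing for rec(N; Mz; x.h.Ms), the index 0 of Ms is the
   recursive result h and the index 1 is the predecessor x. *)
Inductive tm : ctx -> ty -> Set :=
| Var (G : ctx) (s : ty) : var G s -> tm G s
| Lam (G : ctx) (s t : ty) : tm (s :: G) t -> tm G (Arr s t)
| App (G : ctx) (s t : ty) : tm G (Arr s t) -> tm G s -> tm G t
| Zero (G : ctx) : tm G Nat
| Succ (G : ctx) : tm G Nat -> tm G Nat
| Rec (G : ctx) (s : ty) :
    tm G Nat -> tm G s -> tm (s :: Nat :: G) s -> tm G s.

Fixpoint ty_sem (s : ty) : Set :=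
  match s with
  | Nat => nat
  | Arr s t => ty_sem s -> ty_sem t
  end.

Fixpoint ctx_sem (G : ctx) : Set :=
  match G with
  | [::] => unit
  | s :: G => (ty_sem s * ctx_sem G)%type
  end.

Fixpoint var_sem (G : ctx) (s : ty) (x : var G s) : ctx_sem G -> ty_sem s :=
  match x in var G s return ctx_sem G -> ty_sem s with
  | VZ _ _ => fun g => g.1
  | VS _ _ _ y => fun g => var_sem y g.2
  end.

Fixpoint tm_sem (G : ctx) (s : ty) (M : tm G s) : ctx_sem G -> ty_sem s :=
  match M in tm G s return ctx_sem G -> ty_sem s with
  | Var _ _ x => fun g => var_sem x g
  | Lam _ _ _ M => fun g a => tm_sem M (a, g)
  | App _ _ _ M N => fun g => tm_sem M g (tm_sem N g)
  | Zero _ => fun _ => 0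
  | Succ _ M => fun g => (tm_sem M g).+1
  | Rec _ s N Mz Ms => fun g =>
      nat_rec (fun _ => ty_sem s)
        (tm_sem Mz g) (fun n r => tm_sem Ms (r, (n, g))) (tm_sem N g)
  end.

(* [mkseq alpha k] is the list of the first k values of alpha. *)
Definition TBar (Q : seq nat -> Prop) (u : seq nat) : Prop :=
  exists F : tm [::] (Arr (Arr Nat Nat) Nat),
  forall alpha : nat -> nat, Q (u ++ mkseq alpha (tm_sem F tt alpha)).

(* Main.v *)
(** System T is interpreted a second time, with dialogue trees in place of
    natural numbers (Escardo).  A closed functional F of type
    (nat -> nat) -> nat, applied to the generic sequence, becomes a
    well-founded tree that computes F(alpha) by querying alpha, as a logical
    relation indexed by alpha shows.  Induction on this tree then gives the
    inductive bar: a query at position i is answered by lengthening the current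
    list beyond i, and at a leaf n it suffices to lengthen it to size n, since
    Q is monotone. *)

Require Import Defs.
From mathcomp Require Import all_boot.

Set Implicit Arguments.
Unset Strict Implicit.
Unset Printing Implicit Defensive.

Inductive dialogue : Set :=
| Answer : nat -> dialogue
| Query : nat -> (nat -> dialogue) -> dialogue.

Fixpoint run (d : dialogue) (alpha : nat -> nat) : nat :=
  match d with
  | Answer n => n
  | Query i k => run (k (alpha i)) alpha
  end.

Fixpoint bind (f : nat -> dialogue) (d : dialogue) : dialogue :=
  match d with
  | Answer n => f n
  | Query i k => Query i (fun x => bind f (k x))
  end.

Lemma run_bind f d alpha : run (bind f d) alpha = run (f (run d alpha)) alpha.
Proof. by elim: d => [//|i k IHk] /=; rewrite IHk. Qed.

Definition generic : dialogue -> dialogue := bind (fun i => Query i Answer).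

Fixpoint ty_dial (s : ty) : Set :=
  match s with
  | Nat => dialogue
  | Arr s t => ty_dial s -> ty_dial t
  end.

Fixpoint ctx_dial (G : ctx) : Set :=
  match G with
  | [::] => unit
  | s :: G => (ty_dial s * ctx_dial G)%type
  end.

(** Kleisli extension, taken pointwise at arrow types: it lets [Rec] produce a result of any type
    although the number recursed on is only a tree. *)
Fixpoint ty_bind (s : ty) : (nat -> ty_dial s) -> dialogue -> ty_dial s :=
  match s return (nat -> ty_dial s) -> dialogue -> ty_dial s with
  | Nat => bind
  | Arr s t => fun f d a => ty_bind (fun n => f n a) d
  end.

Fixpoint var_dial (G : ctx) (s : ty) (x : var G s) : ctx_dial G -> ty_dial s :=
  match x in var G s return ctx_dial G -> ty_dial s with
  | VZ _ _ => fun g => g.1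
  | VS _ _ _ y => fun g => var_dial y g.2
  end.

Fixpoint tm_dial (G : ctx) (s : ty) (M : tm G s) : ctx_dial G -> ty_dial s :=
  match M in tm G s return ctx_dial G -> ty_dial s with
  | Var _ _ x => fun g => var_dial x g
  | Lam _ _ _ M => fun g a => tm_dial M (a, g)
  | App _ _ _ M N => fun g => tm_dial M g (tm_dial N g)
  | Zero _ => fun _ => Answer 0
  | Succ _ M => fun g => bind (fun n => Answer n.+1) (tm_dial M g)
  | Rec _ s N Mz Ms => fun g =>
      ty_bind
        (nat_rec (fun _ => ty_dial s) (tm_dial Mz g)
           (fun n r => tm_dial Ms (r, (Answer n, g))))
        (tm_dial N g)
  end.

Section LogicalRelation.

Variable alpha : nat -> nat.

Fixpoint ty_rel (s : ty) : ty_sem s -> ty_dial s -> Prop :=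
  match s return ty_sem s -> ty_dial s -> Prop with
  | Nat => fun n d => n = run d alpha
  | Arr s t => fun f f' => forall a a', ty_rel a a' -> ty_rel (f a) (f' a')
  end.

Fixpoint ctx_rel (G : ctx) : ctx_sem G -> ctx_dial G -> Prop :=
  match G return ctx_sem G -> ctx_dial G -> Prop with
  | [::] => fun _ _ => True
  | s :: G => fun g g' => ty_rel g.1 g'.1 /\ ctx_rel g.2 g'.2
  end.

Lemma ty_rel_bind s (f : nat -> ty_sem s) (f' : nat -> ty_dial s) d :
  (forall n, ty_rel (f n) (f' n)) -> ty_rel (f (run d alpha)) (ty_bind f' d).
Proof.
elim: s f f' => [|s _ t IHt] f f' ff' /=; first by rewrite run_bind ff'.
by move=> a a' aa'; apply: (IHt (f^~ a) (f'^~ a')) => n; apply: ff'.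
Qed.

Lemma var_rel G s (x : var G s) g g' :
  ctx_rel g g' -> ty_rel (var_sem x g) (var_dial x g').
Proof. by elim: x g g' => [G0 s0|G0 s0 t x IHx] g g' [] //= _; apply: IHx. Qed.

Lemma tm_rel G s (M : tm G s) g g' :
  ctx_rel g g' -> ty_rel (tm_sem M g) (tm_dial M g').
Proof.
elim: M g g' => {G s} [G s x|G s t M IHM|G s t M IHM N IHN|G|G M IHM
  |G s N IHN Mz IHz Ms IHs] g g' gg' //=.
- exact: var_rel.
- by move=> a a' aa'; apply: IHM.
- exact: IHM gg' _ _ (IHN _ _ gg').
- by rewrite run_bind /= (IHM _ _ gg').
- rewrite (IHN _ _ gg').
  (* The recursor is viewed as a function of its numeral, so that [ty_rel_bind] reduces a
     tree-valued argument to the case of a plain numeral [n], settled by induction. *)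
  pose r := nat_rec (fun _ => ty_sem s) (tm_sem Mz g)
    (fun n r => tm_sem Ms (r, (n, g))).
  apply: (ty_rel_bind (f := r)) => n.
  by elim: n => [|n IHn] /=; [apply: IHz | apply: IHs].
Qed.

Lemma generic_rel : ty_rel (s := Arr Nat Nat) alpha generic.
Proof. by move=> n d /= ->; rewrite run_bind. Qed.

End LogicalRelation.

Lemma closed_functional_dialogue (F : tm [::] (Arr (Arr Nat Nat) Nat)) :
  exists d, forall alpha, tm_sem F tt alpha = run d alpha.
Proof.
(* Only the relation depends on [alpha], not the tree, so one tree serves all sequences. *)
exists (tm_dial F tt generic) => alpha.
by apply: (@tm_rel alpha _ _ F tt tt) => //; apply: generic_rel.
Qed.

(** Each use of the digamma rule supplies one of the [n - size u] missing entries. *)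
Lemma IndBar_extend (Q : seq nat -> Prop) n u :
  (forall w, n <= size (u ++ w) -> IndBar Q (u ++ w)) -> IndBar Q u.
Proof.
have [m] := ubnP (n - size u); elim: m u => // m IHm u lt_m barQ.
have [le_n|lt_n] := leqP n (size u).
  by rewrite -[u]cats0; apply: barQ; rewrite cats0.
apply: IndBar_digamma => x; apply: IHm => [|w].
  by rewrite size_rcons subnS prednK ?subn_gt0.
by rewrite cat_rcons; apply: barQ.
Qed.

Definition extends (alpha : nat -> nat) (u : seq nat) : Prop :=
  mkseq alpha (size u) = u.

Lemma extends_catl alpha u w : extends alpha (u ++ w) -> extends alpha u.
Proof.
move=> /(congr1 (take (size u))).
rewrite take_size_cat // /mkseq -map_take take_iota size_cat.
by rewrite (minn_idPl (leq_addr _ _)).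
Qed.

Lemma extends_nth u : extends (nth 0 u) u.
Proof. exact: mkseq_nth. Qed.

(** Restricting to sequences that extend [u] makes the induction on [d] work: once [u] is long
    enough, it fixes the answer to the query at the root. *)
Lemma IndBar_dialogue (Q : seq nat -> Prop) (d : dialogue) u :
    monotone Q ->
    (forall alpha, extends alpha u -> Q (mkseq alpha (run d alpha))) ->
  IndBar Q u.
Proof.
move=> monoQ; elim: d u => [n|i k IHk] u barQ.
  apply: (@IndBar_extend _ n) => w le_n; apply: IndBar_eta.
  (* Padding [u ++ w] with zeros gives a sequence extending [u]; its first [n] values lie within
     [u ++ w] because [n] is at most the size. *)
  apply: monoQ (barQ _ (extends_catl (extends_nth (u ++ w)))) _ => /=.
  rewrite -[X in prefix _ X](mkseq_nth 0) /mkseq -{1}(minn_idPl le_n).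
  by rewrite -take_iota map_take prefix_take.
(* Size [i.+1] is what puts position [i] inside the list. *)
apply: (@IndBar_extend _ i.+1) => w lt_i.
apply: (IHk (nth 0 (u ++ w) i)) => alpha ext_alpha.
have <- : alpha i = nth 0 (u ++ w) i by rewrite -ext_alpha nth_mkseq.
exact/barQ/extends_catl/ext_alpha.
Qed.

Theorem theorem4p1 (Q : seq nat -> Prop) (hQ : monotone Q) :
  TBar Q [::] -> IndBar Q [::].
Proof.
move=> [F barF]; have [d runF] := closed_functional_dialogue F.
by apply: (IndBar_dialogue (d := d)) => // alpha _; rewrite -runF; apply: barF.
Qed.
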